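(* Assume that $\sim$ is an equivalence relation on $\mathcal W$, that the homogeneous Martin kernel $k_{\hom}$ exists, and that for every $w\in\mathcal W$ at least one of the following holds: $m(w)=m(\tilde w)$ for all $\tilde w\sim w$; or $w^-\sim(\tilde w)^-$ for all $\tilde w\sim w$. Then the inhomogeneous Martin boundary $\mathcal M$ (built from the mass distribution $m$) coincides with the homogeneous Martin boundary $\mathcal M_{\hom}$ (built from the uniform mass distribution), i.e. $\mathcal M=\mathcal M_{\hom}$.
   Context: Setting: $\{S_1,\dots,S_N\}$ is a finite family of similitudes $S_i:D\to D$, $D\subseteq\mathbb R^d$, with ratios $0<c_i<1$, and $K$ is its attractor (the unique non-empty compact set with $K=\bigcup_{i=1}^N S_i(K)$). $K$ is assumed connected, and the open set condition holds: there is a non-empty bounded open set $\mathcal O\subset\mathbb R^d$ with $\bigcup_i S_i(\mathcal O)\subset\mathcal O$, the union being disjoint. Words: $\mathcal A=\{1,\dots,N\}$; $\mathcal W=\bigcup_{n\ge1}\mathcal A^n\cup\{\emptyset\}$ is the set of finite words, $\emptyset$ the empty word. For $w=w_1\cdots w_n$: $|w|=n$ ($|\emptyset|=0$), $w^-=w_1\cdots w_{n-1}$ (parent, for $n\ge1$), $S_w=S_{w_1}\circ\cdots\circ S_{w_n}$, $S_\emptyset=\mathrm{id}$. Juxtaposition $vw$ is concatenation. Relation: $v\sim w$ iff $v=w$, or $|v|=|w|$, $S_v(K)\cap S_w(K)\ne\emptyset$ and $v^-\ne w^-$. Mass distribution: $m:\mathcal A\to(0,1)$ with $\sum_{a\in\mathcal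 A}m(a)=1$, extended by $m(\emptyset)=1$ and $m(w_1\cdots w_n)=m(w_1)\cdots m(w_n)$. Transition probability on $\mathcal W$: $p(v,w)=\dfrac{m(w)}{\sum_{\hat v\sim v}m(\hat v)}$ if $w=\hat v i$ for some $\hat v\sim v$, $i\in\mathcal A$, and $p(v,w)=0$ otherwise. $p_0(v,w)=\delta_v(w)$ (Kronecker delta), $p_n(v,w)=\sum_{u\in\mathcal W}p_{n-1}(v,u)p(u,w)$ for $n\ge1$. Green function $g(v,w)=\sum_{n\ge0}p_n(v,w)$. Martin kernel $k(v,w)=g(v,w)/g(\emptyset,w)$. Martin metric: $\rho(v,w)=\sum_{u\in\mathcal W}a(u)|k(u,v)-k(u,w)|$, where $a(u)>0$ for all $u$ and $\sum_{u}a(u)/g(\emptyset,u)<\infty$. $\widehat{\mathcal W}$ is the set of all $\rho$-Cauchy sequences in $\mathcal W$; a sequence $\{w_n\}\subset\mathcal W$ with $|w_n|\to\infty$ is $\rho$-Cauchy iff $\lim_n k(v,w_n)$ exists for all $v\in\mathcal W$. On $\widehat{\mathcal W}$ put $\{v_n\}\eqsim\{w_n\}$ iff $\lim_n k(u,v_n)=\lim_n k(u,w_n)$ for all $u\in\mathcal W$. The Martin space is $\overline{\mathcal W}=\widehat{\mathcal W}/\!\eqsim$ (the $\rho$-completion of $\mathcal W$, with $\mathcal W$ embedded via constant sequences), and the Martin boundary is $\mathcal M=\overline{\mathcal W}\setminus\mathcal W$. Homogeneous case: the subscript $\hom$ denotes the same objects constructed, with the same $\sim$, from the uniform mass distribution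 $m(a)=1/N$ for all $a\in\mathcal A$. *)

(* Defs.v *)
From HB Require Import structures.
From mathcomp Require Import all_boot all_order all_algebra.
From mathcomp Require Import all_classical all_reals all_analysis.

Set Implicit Arguments.
Unset Strict Implicit.
Unset Printing Implicit Defensive.

Import Order.TTheory GRing.Theory Num.Theory.
Import numFieldNormedType.Exports.

Local Open Scope classical_set_scope.
Local Open Scope ring_scope.

(* The library norm of 'rV[R]_d is the sup norm. It gives the usual topology
   and the usual bounded sets, but not the usual similitudes. *)
Definition edist (R : realType) (d : nat) (x y : 'rV[R]_d) : R :=
  Num.sqrt (\sum_(j < d) (x 0 j - y 0 j) ^+ 2).

(* A map D -> D is represented by a total function, whose values outside D are
   irrelevant. *)
Definition similitude (R : realType) (d : nat) (D : set 'rV[R]_d)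
    (f : 'rV[R]_d -> 'rV[R]_d) (c : R) : Prop :=
  f @` D `<=` D /\
  (forall x y, D x -> D y -> edist (f x) (f y) = c * edist x y).

(* For contracting similitudes at most one set K satisfies this. *)
Definition attractor (R : realType) (d N : nat) (D : set 'rV[R]_d)
    (S : 'I_N -> 'rV[R]_d -> 'rV[R]_d) (K : set 'rV[R]_d) : Prop :=
  [/\ K `<=` D, K !=set0, compact K & K = \bigcup_(i in setT) (S i @` K)].

(* The inclusion in D makes the images S i @` O meaningful. *)
Definition open_set_condition (R : realType) (d N : nat) (D : set 'rV[R]_d)
    (S : 'I_N -> 'rV[R]_d -> 'rV[R]_d) : Prop :=
  exists O : set 'rV[R]_d,
    [/\ O !=set0, bounded_set O, open O & O `<=` D] /\
    (\bigcup_(i in setT) (S i @` O) `<=` O /\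
     trivIset setT (fun i => S i @` O)).

(* The word w_1 ... w_n is [:: w_1; ...; w_n]; thus the concatenation w i with
   a letter i is [rcons w i]. *)
Definition word (N : nat) := seq 'I_N.

(* Deletes the last letter; the empty word, which has no parent, is sent to
   itself. *)
Definition parent (N : nat) (w : word N) : word N := take (size w).-1 w.

Definition word_map (T : Type) (N : nat) (S : 'I_N -> T -> T) (w : word N) :
    T -> T :=
  fun x => foldr (fun i => S i) x w.

Definition word_sim (T : Type) (N : nat) (S : 'I_N -> T -> T) (K : set T)
    (v w : word N) : Prop :=
  v = w \/
  [/\ size v = size w,
      (word_map S v @` K) `&` (word_map S w @` K) !=set0 &
      parent v <> parent w].

Definition mass_distribution (R : realType) (N : nat) (m : 'I_N -> R) : Prop :=
  (forall a, 0 < m a < 1) /\ \sum_(a < N) m a = 1.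

Definition uniform_mass (R : realType) (N : nat) : 'I_N -> R :=
  fun _ => N%:R^-1.

Definition word_mass (R : realType) (N : nat) (m : 'I_N -> R) (w : word N) : R :=
  \prod_(a <- w) m a.

Section MartinBoundary.
Context (R : realType) (N : nat).
Context (sim : word N -> word N -> Prop) (m : 'I_N -> R).
Implicit Types (u v w : word N).

(* The sum is taken over a finite set when related words have equal length. *)
Definition transition v w : R :=
  if `[< exists v' i, sim v' v /\ w = rcons v' i >]
  then word_mass m w / \sum_(v' \in [set v' | sim v' v]) word_mass m v'
  else 0.

Fixpoint transition_iter (n : nat) v w : \bar R :=
  match n with
  | 0 => ((v == w)%:R)%:E
  | n'.+1 => \esum_(u in [set: word N])
               (transition_iter n' v u * (transition u w)%:E)%E
  end.

Definition green v w : \bar R :=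
  (\sum_(0 <= n <oo) transition_iter n v w)%E.

Definition martin_kernel v w : R := fine (green v w) / fine (green [::] w).

(* The quotient defining the kernel is a quotient of real numbers with a
   nonzero denominator. *)
Definition martin_kernel_exists : Prop :=
  forall v w, green v w \is a fin_num /\ green [::] w != 0%E.

Definition martin_weight (a : word N -> R) : Prop :=
  (forall u, 0 < a u) /\
  (\esum_(u in [set: word N]) (a u / fine (green [::] u))%:E < +oo)%E.

Definition martin_metric (a : word N -> R) v w : \bar R :=
  \esum_(u in [set: word N])
    (a u * `|martin_kernel u v - martin_kernel u w|)%:E.

Definition martin_cauchy (a : word N -> R) : set (nat -> word N) :=
  [set s | forall e : R, 0 < e -> exists n0 : nat, forall i j : nat,
     (n0 <= i)%N -> (n0 <= j)%N -> (martin_metric a (s i) (s j) < e%:E)%E].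

Definition martin_equiv (s t : nat -> word N) : Prop :=
  forall u, limn (fun n => martin_kernel u (s n)) =
            limn (fun n => martin_kernel u (t n)).

(* The quotient of the set of Cauchy sequences is represented by the set of
   its equivalence classes, so that the boundaries obtained from two mass
   distributions are subsets of the same type. *)
Definition martin_class (a : word N -> R) (s : nat -> word N) :
    set (nat -> word N) :=
  [set t | martin_cauchy a t /\ martin_equiv s t].

Definition martin_space (a : word N -> R) : set (set (nat -> word N)) :=
  martin_class a @` martin_cauchy a.

Definition martin_boundary (a : word N -> R) : set (set (nat -> word N)) :=
  martin_space a `\` range (fun w => martin_class a (fun=> w)).

End MartinBoundary.

(* Main.v *)
Require Import Defs.
From mathcomp Require Import all_boot all_order all_algebra.
From mathcomp Require Import finmap lra.
From mathcomp Require Import all_classical all_reals all_analysis.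
Set Implicit Arguments.
Unset Strict Implicit.
Import Order.TTheory GRing.Theory Num.Theory.
Import numFieldNormedType.Exports.
Local Open Scope classical_set_scope.
Local Open Scope ring_scope.

(** Why the two boundaries coincide.

    Both Martin boundaries are computed to be one and the same set, which is
    built from the equivalence on words alone ([ratio_boundary]).

    Every step of the chain lengthens the word by one letter, so the Green
    function from [v] to [w] is the probability of one transition in
    [size w - size v] steps ([greenE]), a finite real number.  As [sim] is an
    equivalence, the chain started at [v] enters [w] with probability
    [m(w) / M(parent w)] once it is in the class of [parent w], where [M] is
    the total mass of a class.  Summing over the class of [w] and dividing by
    [M(w)] turns this into a recursion for the density of the law of the chain
    on classes.  Either alternative of the hypothesis on [m] makes the density
    at [w] the plain average of the densities at the parents of the members of
    the class of [w]: if [m] is constant on the class, the weights cancel; if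
    the parents are equivalent, all the averaged values are equal.  The
    averaging recursion does not see [m], which enters through the starting
    value [1 / M(v)] only ([class_step_prob]).  Hence for [size v < size w] the
    Martin kernel is a positive constant depending on [v] times a function of
    [v] and [w] that does not involve [m] ([martin_kernel_ratio]).

    If [w] is not longer than [v], the comparison needs another constant, so
    sequences that stay bounded must be separated from the others.  The chain
    passes every level exactly once, so the numbers [g([],u) k(u,w)], with [u]
    of length [l], add up to [1] as soon as [l <= size w]
    ([martin_kernel_level]).  Consequently the kernels can only converge to
    those at a word along a sequence that is eventually this word
    ([martin_kernel_cvg_word]), and a Cauchy sequence either is eventually
    constant or has lengths tending to infinity ([convergent_cases]).  Since
    [g([],u) g(u,w) <= g([],w)], also [k(u,w) <= 1 / g([],u)], by which the
    summability of the weights reduces the metric to pointwise convergence of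
    the kernels ([martin_cauchyP]).

    The boundary therefore consists of the classes of the sequences with
    lengths tending to infinity along which all kernels converge, and on these
    the positive constants affect neither convergence nor equality of limits
    ([martin_boundaryE]).  Uniform masses satisfy the hypothesis trivially,
    because equivalent words have the same length. *)

(** * Finite sums and summable families *)

Lemma fsumr_gt0_term (R : realDomainType) (I : choiceType) (A : set I)
    (f : I -> R) (i : I) :
  finite_set A -> (forall j, A j -> 0 <= f j) -> A i -> 0 < f i ->
  0 < \sum_(j \in A) f j.
Proof.
move=> finA f0 Ai fi0; rewrite (fsbigD1 i)//=.
by rewrite ltr_wpDr// fsumr_ge0// => j [/f0].
Qed.

Lemma ler_fsumr_term (R : realDomainType) (I : choiceType) (A : set I)
    (f : I -> R) (i : I) :
  finite_set A -> (forall j, A j -> 0 <= f j) -> A i ->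
  f i <= \sum_(j \in A) f j.
Proof.
move=> finA f0 Ai; rewrite (fsbigD1 i)//=.
by rewrite lerDl fsumr_ge0// => j [/f0].
Qed.

Lemma cvg_fsumr (R : realType) (I : choiceType) (A : set I)
    (f : I -> nat -> R) (l : I -> R) : finite_set A ->
  (forall i, f i n @[n --> \oo] --> l i) ->
  \sum_(i \in A) f i n @[n --> \oo] --> \sum_(i \in A) l i.
Proof.
move=> finA fl; rewrite fsbig_finite//.
under eq_fun do rewrite fsbig_finite//.
by apply: cvg_big => //; exact: add_continuous.
Qed.

(** The finite partial sums approach the total from below, and what such a sum
    leaves out is exactly the series over the complement. *)
Lemma esum_tail_small (R : realType) (T : choiceType) (b : T -> R) (e : R) :
  (forall t, 0 <= b t) -> (\esum_(t in [set: T]) (b t)%:E < +oo)%E -> 0 < e ->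
  exists2 F : set T, finite_set F & (\esum_(t in ~` F) (b t)%:E < e%:E)%E.
Proof.
move=> b0 bfin e0.
have finS : (\esum_(t in [set: T]) (b t)%:E)%E \is a fin_num.
  by rewrite ge0_fin_numE// esum_ge0// => t _; rewrite lee_fin.
have : (\esum_(t in [set: T]) (b t)%:E - e%:E < \esum_(t in [set: T]) (b t)%:E)%E.
  by rewrite lteBlDr// lteDl// lte_fin.
move=> /ereal_sup_gt[_ [F [finF _] <-]]; rewrite -esum_fset//; last first.
  by move=> t _; rewrite lee_fin.
rewrite (esumID F setT) ?setTI//; last by move=> t _; rewrite lee_fin.
move=> h; exists F => //; move: h.
have : (\esum_(t in F) (b t)%:E)%E \is a fin_num.
  rewrite esum_fset//; last by move=> t _; rewrite lee_fin.
  by rewrite fsumEFin.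
move=> finF'; rewrite lteBlDr// lteD2lE//.
Qed.

(** * Words *)

Section Words.
Context (R : realType) (N : nat).
Implicit Types (u v w : word N).

Definition level (n : nat) : set (word N) := [set w | size w = n].

Lemma finite_level n : finite_set (level n).
Proof.
apply: (@sub_finite_set _ _ [set` [seq val t | t : n.-tuple 'I_N]]).
  move=> w /= /eqP wn; apply/mapP; exists (Tuple wn) => //.
  by rewrite mem_enum.
exact: finite_seq.
Qed.

Lemma finite_short L : finite_set [set w : word N | (size w <= L)%N].
Proof.
rewrite (_ : [set _ | _] = \bigcup_(n in `I_L.+1) level n).
  by apply: bigcup_finite => // n _; exact: finite_level.
by apply/seteqP; split=> [w wL|w [n /= nL wn]] //=; [exists (size w)|rewrite wn].
Qed.

Lemma size_parent w : size (parent w) = (size w).-1.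
Proof. by rewrite /parent size_take; case: w => //= a s; rewrite ltnS leqnn. Qed.

Lemma parent_rcons w i : parent (rcons w i) = w.
Proof. by rewrite /parent size_rcons -cats1 take_size_cat. Qed.

Lemma word_mass_gt0 (m : 'I_N -> R) w : (forall a, 0 < m a) -> 0 < word_mass m w.
Proof. by move=> m0; rewrite /word_mass prodr_gt0. Qed.

End Words.

Section Chain.
Context (R : realType) (N : nat) (sim : word N -> word N -> Prop).
Context (sim_equiv : RelationClasses.Equivalence sim).
Context (sim_size : forall v w, sim v w -> size v = size w).
Implicit Types (u v w : word N).

(** * Equivalence classes of words *)

Definition sim_class w : set (word N) := [set v | sim v w].

Lemma sim_refl w : sim w w.
Proof. by case: sim_equiv => r s t; exact: r. Qed.

Lemma finite_sim_class w : finite_set (sim_class w).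
Proof.
apply: sub_finite_set (finite_level N (size w)) => v; exact: sim_size.
Qed.

Hint Resolve finite_sim_class sim_refl : core.

Lemma sim_class_eq v w : sim v w -> sim_class v = sim_class w.
Proof.
case: sim_equiv => r s t vw; apply/seteqP; split=> u /= uv; apply: t uv _ => //.
exact: s.
Qed.

(** * Densities on classes *)

Definition class_card w : R := \sum_(u \in sim_class w) (1 : R).

Lemma class_card_gt0 w : 0 < class_card w.
Proof. exact: (@fsumr_gt0_term _ _ _ _ w). Qed.

(** The density, at the class of [w], of the law after [n] steps of the chain
    started at [v], up to the factor [1 / M(v)]: see [class_step_prob].  It is
    defined by plain averaging over the class so that no mass enters. *)
Fixpoint density (n : nat) v w : R :=
  if n is n'.+1 then
    (\sum_(u \in sim_class w) density n' v (parent u)) / class_card w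
  else `[< sim v w >]%:R.

Lemma density_class n v w w' : sim w w' -> density n v w = density n v w'.
Proof.
case: n => [|n] ww' /=; last by rewrite /class_card (sim_class_eq ww').
congr (_%:R); congr nat_of_bool; case: sim_equiv => r s t.
apply: asbool_equiv_eq; split=> h; [exact: t h ww'|].
by apply: t h _; exact: s.
Qed.

(** The quotient of the densities for the starting words [v] and [[::]].  The
    last step of the chain, from the class of [parent w] into [w], has the same
    probability for both and cancels; hence the densities at [parent w]. *)
Definition density_ratio v w : R :=
  density (size w - size v).-1 v (parent w) /
  density (size w).-1 [::] (parent w).

Definition escaping (s : nat -> word N) : Prop :=
  forall L, \forall n \near \oo, (L < size (s n))%N.

(** The shape of [martin_class] with densities in place of Martin kernels. *)
Definition ratio_class (s : nat -> word N) : set (nat -> word N) :=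
  [set t | escaping t /\ forall u, cvgn (fun n => density_ratio u (t n)) /\
     limn (fun n => density_ratio u (s n)) = limn (fun n => density_ratio u (t n))].

Definition ratio_boundary : set (set (nat -> word N)) :=
  ratio_class @` [set s | escaping s /\
    forall u, cvgn (fun n => density_ratio u (s n))].

Context (m : 'I_N -> R) (m_gt0 : forall a, 0 < m a).

(** * The Green function *)

Definition class_mass w : R := \sum_(v \in sim_class w) word_mass m v.

Lemma class_mass_gt0 w : 0 < class_mass w.
Proof.
apply: (@fsumr_gt0_term _ _ _ _ w) => // [v _|]; last exact: word_mass_gt0.
exact/ltW/word_mass_gt0.
Qed.

Lemma class_mass_eq v w : sim v w -> class_mass v = class_mass w.
Proof. by move=> vw; rewrite /class_mass (sim_class_eq vw). Qed.

(** The probability of going from [v] to [w] in [n] steps when [w] is [n]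
    letters longer than [v].  Conditioning on the last step leaves a finite sum
    over the class of [parent w].  Without this assumption on the lengths the
    value may be a different one, since [[::]] is its own parent. *)
Fixpoint step_prob (n : nat) v w : R :=
  if n is n'.+1 then
    word_mass m w / class_mass (parent w) *
      \sum_(u \in sim_class (parent w)) step_prob n' v u
  else (v == w)%:R.

Lemma step_prob_ge0 n v w : 0 <= step_prob n v w.
Proof.
elim: n w => [|n IH] w /=; first exact: ler0n.
rewrite mulr_ge0 ?fsumr_ge0// divr_ge0 ?ltW//; first exact: word_mass_gt0.
exact: class_mass_gt0.
Qed.

(** By reflexivity the chain can move along the prefixes of [w]. *)
Lemma step_prob_root_gt0 w : 0 < step_prob (size w) [::] w.
Proof.
move wn : (size w) => n; elim: n w wn => [|n IH] w /=.
  by move/size0nil => ->.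
move=> wn; rewrite mulr_gt0 ?divr_gt0 ?word_mass_gt0 ?class_mass_gt0//.
apply: (@fsumr_gt0_term _ _ _ _ (parent w)) => // [u _|].
  exact: step_prob_ge0.
by apply: IH; rewrite size_parent wn.
Qed.

(** The denominator of the transition is the mass of the class of [u], which by
    transitivity is the class of [w] whenever the move is possible. *)
Lemma transition_rcons u w i :
  transition sim m u (rcons w i) =
  if u \in sim_class w then word_mass m (rcons w i) / class_mass w else 0.
Proof.
case: sim_equiv => r s t; rewrite /transition.
have -> : `[< exists v' j, sim v' u /\ rcons w i = rcons v' j >]
          = (u \in sim_class w).
  apply/asboolP/idP => [[v [j [vu /rcons_inj[-> _]]]]|].
    by rewrite inE; exact: s.
  by rewrite inE => uw; exists w, i; split=> //; exact: s.
by case: ifPn => //; rewrite inE => uw; rewrite -(class_mass_eq uw).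
Qed.

Lemma transition_nil u : transition sim m u [::] = 0.
Proof.
rewrite /transition; case: ifPn => // /asboolP[v [i [_ e]]].
by have := size_rcons v i; rewrite -e.
Qed.

(** The sum over all intermediate words is supported on the class of the parent
    of [w], because a last step into [w] starts there. *)
Lemma transition_iterE n v w :
  transition_iter sim m n v w =
  (if size w == (size v + n)%N then step_prob n v w else 0)%:E.
Proof.
elim: n w => [|n IH] w /=.
  rewrite addn0; case: eqVneq => [->|]; first by rewrite eqxx.
  by rewrite if_same.
case: (lastP w) => [|w' i].
  rewrite addnS /= esum1// => u _.
  by rewrite transition_nil mule0.
rewrite size_rcons addnS eqSS parent_rcons.
transitivity (\esum_(u in sim_class w')
  ((if size w' == (size v + n)%N then step_prob n v u else 0) *
   (word_mass m (rcons w' i) / class_mass w'))%:E)%E.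
  rewrite [RHS]esum_mkcond; apply: eq_esum => u _.
  rewrite IH transition_rcons.
  have [uw|uw] := boolP (u \in sim_class w'); last by rewrite mule0.
  by move: (uw); rewrite inE => /sim_size ->.
rewrite esum_fset//; last first.
  move=> u _; rewrite lee_fin mulr_ge0//.
    by case: ifP => // _; exact: step_prob_ge0.
  by rewrite divr_ge0 ?ltW ?word_mass_gt0 ?class_mass_gt0.
rewrite fsumEFin//; congr (_%:E); case: ifP => _.
  by rewrite mulr_fsumr; apply: eq_fsbigr => u _; rewrite mulrC.
by rewrite fsbig1// => u _; rewrite mul0r.
Qed.

(** For [size w <= size v] the truncated difference makes this the Kronecker
    delta, in agreement with the Green function. *)
Definition green_real v w : R := step_prob (size w - size v) v w.

(** Lengths grow by one at each step, so only one term of the series can be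
    nonzero. *)
Lemma greenE v w : green sim m v w = (green_real v w)%:E.
Proof.
rewrite /green nneseries_esumT; last first.
  move=> n; rewrite transition_iterE lee_fin; case: ifP => // _.
  exact: step_prob_ge0.
rewrite -(@esum_set1 _ _ (size w - size v)%N (fun=> (green_real v w)%:E));
  last by rewrite lee_fin step_prob_ge0.
rewrite [RHS]esum_mkcond; apply: eq_esum => n _; rewrite transition_iterE.
case: ifPn => [/eqP wn|wn].
  by rewrite mem_set /green_real ?wn ?addKn.
case: ifPn => //; rewrite inE /= => nE.
have /eqP wv0 : (size w - size v == 0)%N.
  apply: contraNT wn; rewrite subn_eq0 -ltnNge => /ltnW vw.
  by rewrite nE subnKC.
rewrite /green_real wv0 /=.
case: eqVneq => // vw; move: wn; rewrite nE vw subnn addn0 eqxx //.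
Qed.

Lemma green_real_ge0 v w : 0 <= green_real v w. Proof. exact: step_prob_ge0. Qed.

Lemma green_root_gt0 w : 0 < green_real [::] w.
Proof. by rewrite /green_real subn0; exact: step_prob_root_gt0. Qed.

Lemma green_real_short v w : (size w <= size v)%N -> green_real v w = (v == w)%:R.
Proof. by rewrite /green_real -subn_eq0 => /eqP ->. Qed.

(** The Chapman-Kolmogorov identity at time [l]: a path from the empty word is
    then at a word of length [l]. *)
Lemma step_prob_level l n w : size w = (l + n)%N ->
  \sum_(u \in level l) step_prob l [::] u * step_prob n u w =
  step_prob (l + n) [::] w.
Proof.
elim: n w => [|n IH] w.
  rewrite !addn0 => wl; rewrite (fsbigD1 w)//=; last exact: finite_level.
  rewrite eqxx mulr1 fsbig1 ?addr0// => u [_ /= /eqP/negbTE ->].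
  by rewrite mulr0.
rewrite addnS => wl /=.
have pl u : sim_class (parent w) u -> size u = (l + n)%N.
  by move=> /sim_size ->; rewrite size_parent wl.
transitivity (word_mass m w / class_mass (parent w) *
    \sum_(u \in sim_class (parent w))
      \sum_(x \in level l) step_prob l [::] x * step_prob n x u); last first.
  by congr (_ * _); apply: eq_fsbigr => u; rewrite inE => /pl/IH.
rewrite exchange_fsbig//; last exact: finite_level.
rewrite mulr_fsumr; apply: eq_fsbigr => x _.
by rewrite -mulr_fsumr mulrCA.
Qed.

Lemma green_level l w : (l <= size w)%N ->
  \sum_(u \in level l) green_real [::] u * green_real u w = green_real [::] w.
Proof.
move=> lw; have wl : size w = (l + (size w - l))%N by rewrite subnKC.
rewrite [RHS]/green_real /= subn0 wl -step_prob_level//.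
by apply: eq_fsbigr => u; rewrite inE /green_real /= subn0 => ->.
Qed.

Lemma green_root_le u w :
  green_real [::] u * green_real u w <= green_real [::] w.
Proof.
have [uw|wu] := leqP (size u) (size w); last first.
  rewrite (green_real_short (ltnW wu)); case: eqVneq => [uw|_].
    by move: wu; rewrite uw ltnn.
  by rewrite mulr0 green_real_ge0.
rewrite -(green_level uw).
apply: (@ler_fsumr_term _ _ _
  (fun x => green_real [::] x * green_real x w) u) => //.
  exact: finite_level.
by move=> x _; rewrite mulr_ge0 ?green_real_ge0.
Qed.

(** * The Martin kernel *)

Lemma martin_kernelE v w :
  martin_kernel sim m v w = green_real v w / green_real [::] w.
Proof. by rewrite /martin_kernel !greenE. Qed.

Lemma martin_kernel_ge0 u w : 0 <= martin_kernel sim m u w.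
Proof. by rewrite martin_kernelE divr_ge0 ?green_real_ge0. Qed.

Lemma martin_kernel_le u w : martin_kernel sim m u w <= (green_real [::] u)^-1.
Proof.
rewrite martin_kernelE ler_pdivrMr ?green_root_gt0// mulrC.
rewrite ler_pdivlMr ?green_root_gt0//.
by rewrite mulrC green_root_le.
Qed.

Lemma martin_kernel_short u w : (size w <= size u)%N -> u != w ->
  martin_kernel sim m u w = 0.
Proof.
by move=> wu /negbTE uw; rewrite martin_kernelE green_real_short// uw mul0r.
Qed.

Lemma martin_kernel_diag w : 0 < martin_kernel sim m w w.
Proof.
by rewrite martin_kernelE green_real_short// eqxx divr_gt0 ?green_root_gt0.
Qed.

(** The chain conditioned to reach [w] is at exactly one word of length [l] at
    time [l]; the summands are the probabilities of these words. *)
Lemma martin_kernel_level l w : (l <= size w)%N ->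
  \sum_(u \in level l) green_real [::] u * martin_kernel sim m u w = 1.
Proof.
move=> lw; apply: (mulIf (lt0r_neq0 (green_root_gt0 w))).
rewrite mul1r -[RHS](green_level lw) mulr_fsuml; apply: eq_fsbigr => u _.
by rewrite martin_kernelE mulrA divfK// lt0r_neq0// green_root_gt0.
Qed.

(** * Convergence of the Martin kernels *)

(** The topology induced on words is discrete.  At the level just beyond [w] all
    kernels tend to [0], so [martin_kernel_level] bounds the lengths of [s n] by
    that of [w]; and [k(w, .)] vanishes at all other words that are not longer than
    [w], whereas it is positive at [w]. *)
Lemma martin_kernel_cvg_word (s : nat -> word N) w :
  (forall u, martin_kernel sim m u (s n) @[n --> \oo]
     --> martin_kernel sim m u w) ->
  \forall n \near \oo, s n = w.
Proof.
move=> kw; pose l := (size w).+1.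
have T0 : \sum_(u \in level l) green_real [::] u * martin_kernel sim m u (s n)
          @[n --> \oo] --> (0 : R).
  have h u : green_real [::] u * martin_kernel sim m u (s n) @[n --> \oo] -->
             green_real [::] u * martin_kernel sim m u w.
    by apply: cvgM; [exact: cvg_cst|exact: kw].
  have := cvg_fsumr (finite_level N l) h.
  rewrite [X in _ --> X -> _]fsbig1// => u /= ul.
  rewrite martin_kernel_short ?mulr0// ?ul//.
  by apply/eqP => uw; move/eqP: ul; rewrite uw /l eqn_leq ltnn andbF.
have S1 := cvgr_lt _ T0 _ (ltr01 : 0 < 1 :> R).
have K0 := cvgr_neq0 _ (kw w) (lt0r_neq0 (martin_kernel_diag w)).
near=> n.
have sw : (size (s n) <= size w)%N.
  rewrite leqNgt; apply/negP => ws.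
  have : \sum_(u \in level l) green_real [::] u * martin_kernel sim m u (s n) < 1.
    by near: n; exact: S1.
  by rewrite martin_kernel_level// ltxx.
have : martin_kernel sim m w (s n) != 0 by near: n; exact: K0.
by case: (eqVneq w (s n)) => [->//|wn]; rewrite martin_kernel_short// eqxx.
Unshelve. all: by end_near. Qed.

Lemma eventually_word (s : nat -> word N) w :
  (forall u, cvgn (fun n => martin_kernel sim m u (s n))) ->
  (forall u, limn (fun n => martin_kernel sim m u (s n)) =
     martin_kernel sim m u w) ->
  \forall n \near \oo, s n = w.
Proof.
move=> cs ls; apply: martin_kernel_cvg_word => u; rewrite -ls; exact: cs.
Qed.

(** A single term of the metric controls each kernel, which gives one direction.
    For the other, the terms are dominated by [a(u) / g([],u)], whose tail is
    small uniformly in the sequence; finitely many kernels remain. *)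
Lemma martin_cauchyP (a : word N -> R) (s : nat -> word N) :
  martin_weight sim m a ->
  martin_cauchy sim m a s <->
  forall u, cvgn (fun n => martin_kernel sim m u (s n)).
Proof.
move=> [a0 afin]; split=> [cs u|cs e e0].
  apply/cauchy_cvgP/cauchy_exP => e e0.
  have [n0 sn0] := cs (a u * e) (mulr_gt0 (a0 u) e0).
  exists (martin_kernel sim m u (s n0)); exists n0 => // n /= n0n.
  have := sn0 n0 n (leqnn _) n0n; rewrite /ball /= => h.
  rewrite -(ltr_pM2l (a0 u)) -lte_fin; apply: le_lt_trans h.
  apply: esum_ge; exists [set u]; first by split=> //; exact: finite_set1.
  by rewrite fsbig_set1.
pose b u := a u / green_real [::] u.
have b0 u : 0 <= b u by rewrite divr_ge0 ?green_real_ge0// ltW.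
have bfin : (\esum_(u in [set: word N]) (b u)%:E < +oo)%E.
  by move: afin; under eq_esum do rewrite greenE.
have e2 : 0 < e / 2 by rewrite divr_gt0.
have e4 : 0 < e / 2 / 2 by rewrite divr_gt0.
have [F finF tail] := esum_tail_small b0 bfin e2.
pose l u := limn (fun n => martin_kernel sim m u (s n)).
(* Beyond [F] the metric costs less than [e / 2]; on [F] it is split at the
   limits [l u], and each half has to cost less than [e / 4]. *)
have near0 : \sum_(u \in F) a u * `|martin_kernel sim m u (s n) - l u|
          @[n --> \oo] --> (0 : R).
  have h u : a u * `|martin_kernel sim m u (s n) - l u| @[n --> \oo] -->
             a u * `|l u - l u|.
    apply: cvgM; first exact: cvg_cst.
    by apply: cvg_norm; apply: cvgB; [exact: cs|exact: cvg_cst].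
  have := cvg_fsumr finF h.
  by rewrite [X in _ --> X -> _]fsbig1// => u _; rewrite subrr normr0 mulr0.
have [n0 _ hn0] := cvgr_lt _ near0 _ e4.
exists n0 => i j n0i n0j; rewrite /martin_metric.
rewrite (esumID F setT) ?setTI//; last first.
  by move=> u _; rewrite lee_fin mulr_ge0// ltW.
rewrite [e]splitr EFinD lteD//; last first.
  apply: le_lt_trans tail; apply: le_esum => u _; rewrite lee_fin /b.
  rewrite ler_pM2l// ler_norml.
  have := martin_kernel_ge0 u (s i); have := martin_kernel_ge0 u (s j).
  have := martin_kernel_le u (s i); have := martin_kernel_le u (s j).
  move: (_ ^-1) (martin_kernel _ _ _ _) (martin_kernel _ _ _ _) => *; lra.
rewrite esum_fset//; last by move=> u _; rewrite lee_fin mulr_ge0// ltW.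
rewrite fsumEFin// lte_fin.
rewrite [e / 2]splitr; apply: le_lt_trans _ (ltrD (hn0 i n0i) (hn0 j n0j)).
rewrite -fsbig_split//= !fsbig_finite//; apply: ler_sum => u _.
rewrite -mulrDr ler_pM2l// [X in _ <= _ + X]distrC.
exact: ler_distD.
Qed.

Lemma escaping_not_eventually_word (s : nat -> word N) w :
  escaping s -> ~ (\forall n \near \oo, s n = w).
Proof.
move=> /(_ (size w)) sinf sw.
have : \forall n \near \oo, False.
  by apply: filterS2 sinf sw => n wn sn; move: wn; rewrite sn ltnn.
by move=> /filter_ex[].
Qed.

(** If [s] is not eventually a given word [w], then the limits of the kernels are
    not the kernels at [w], so [s] visits [w] only finitely often.  There are
    finitely many words up to a given length. *)
Lemma convergent_cases (s : nat -> word N) :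
  (forall u, cvgn (fun n => martin_kernel sim m u (s n))) ->
  escaping s \/ exists w, \forall n \near \oo, s n = w.
Proof.
move=> cs; have [[w]|nw] := pselect (exists w, \forall n \near \oo, s n = w).
  by right; exists w.
left => L.
have rare w : \forall n \near \oo, s n != w.
  have [u /eqP kuw] : exists u,
      limn (fun n => martin_kernel sim m u (s n)) <> martin_kernel sim m u w.
    apply/existsNP => h; apply: nw; exists w; exact: eventually_word.
  have k0 : (martin_kernel sim m u (s n) - martin_kernel sim m u w)
       @[n --> \oo] --> (limn (fun n => martin_kernel sim m u (s n)) -
                        martin_kernel sim m u w).
    by apply: cvgB; [exact: cs|exact: cvg_cst].
  have : limn (fun n => martin_kernel sim m u (s n)) - martin_kernel sim m u w != 0.
    by rewrite subr_eq0.
  move=> /(cvgr_neq0 _ k0); apply: filterS => n.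
  by apply: contraNneq => ->; rewrite subrr.
have : \oo (\bigcap_(w in [set` fset_set [set w : word N | (size w <= L)%N]])
             [set n | s n != w]).
  by apply: filter_bigI => w _; exact: rare.
apply: filterS => n sn; rewrite ltnNge; apply/negP => snL.
suff: s n != s n by rewrite eqxx.
by apply: sn; rewrite /= in_fset_set ?inE//; exact: finite_short.
Qed.

(** * Comparison of the kernel with the densities *)

Definition kernel_scale v : R := class_mass [::] / class_mass v.

Lemma kernel_scale_gt0 v : 0 < kernel_scale v.
Proof. by rewrite divr_gt0 ?class_mass_gt0. Qed.

Section Coherent.
Context (coherent : forall w,
  (forall w', sim w' w -> word_mass m w = word_mass m w') \/
  (forall w', sim w' w -> sim (parent w) (parent w'))).

(** Both alternatives lead to the same averaging.  Where the masses agree on the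
    class they factor out, and [M(w) = m(w) * class_card w].  Where the parents
    are equivalent, all the averaged densities are equal. *)
Lemma class_step_prob n v w :
  \sum_(u \in sim_class w) step_prob n v u =
  class_mass w / class_mass v * density n v w.
Proof.
have M0 x : class_mass x != 0 by rewrite lt0r_neq0// class_mass_gt0.
elim: n w => [|n IH] w /=.
  have [vw|nvw] := asboolP (sim v w).
    rewrite (class_mass_eq vw) divff// mulr1 (fsbigD1 v)//= eqxx fsbig1 ?addr0//.
    by move=> u [_ /= /eqP]; rewrite eq_sym => /negbTE ->.
  rewrite mulr0 fsbig1// => u /= uw; case: eqVneq => // vu; exfalso.
  by apply: nvw; rewrite vu.
have card0 := lt0r_neq0 (class_card_gt0 w).
transitivity (\sum_(u \in sim_class w)
    (word_mass m u * density n v (parent u)) / class_mass v).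
  apply: eq_fsbigr => u _; rewrite IH.
  by rewrite mulrA mulrA divfK// mulrAC.
rewrite -mulr_fsuml mulrAC; congr (_ / _).
case: (coherent w) => h.
  have -> : class_mass w = word_mass m w * class_card w.
    by rewrite mulr_fsumr; apply: eq_fsbigr => u; rewrite inE mulr1 => /h ->.
  rewrite -mulrA [X in _ * X]mulrC divfK// mulr_fsumr.
  by apply: eq_fsbigr => u; rewrite inE => /h ->.
have e u : u \in sim_class w -> density n v (parent u) = density n v (parent w).
  by rewrite inE => /h /(density_class n v) ->.
have -> : \sum_(u \in sim_class w) density n v (parent u) =
          class_card w * density n v (parent w).
  by rewrite mulr_fsuml; apply: eq_fsbigr => u uw; rewrite mul1r e.
rewrite mulrAC divff// mul1r mulr_fsuml.
by apply: eq_fsbigr => u uw; rewrite e.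
Qed.

Lemma green_density v w : (size v < size w)%N ->
  green_real v w = word_mass m w / class_mass v *
                  density (size w - size v).-1 v (parent w).
Proof.
rewrite /green_real -subn_gt0; case: (_ - _)%N => // n _ /=.
rewrite class_step_prob mulrA mulrA divfK//.
by rewrite lt0r_neq0// class_mass_gt0.
Qed.

(** The mass of [w] cancels in the quotient of the two Green functions. *)
Lemma martin_kernel_ratio v w : (size v < size w)%N ->
  martin_kernel sim m v w = kernel_scale v * density_ratio v w.
Proof.
move=> vw; have w0 : (0 < size w)%N by exact: leq_ltn_trans vw.
rewrite martin_kernelE !green_density//= subn0 /kernel_scale /density_ratio.
rewrite !invfM invrK.
set p := word_mass m w; have p0 : p != 0 := lt0r_neq0 (word_mass_gt0 w m_gt0).
by rewrite mulrACA [p / _ * _]mulrACA divff// mul1r [_^-1 * _]mulrC.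
Qed.

Lemma kernel_ratio_near (s : nat -> word N) u : escaping s ->
  \forall n \near \oo,
    martin_kernel sim m u (s n) = kernel_scale u * density_ratio u (s n).
Proof. by move=> /(_ (size u)); apply: filterS => n /martin_kernel_ratio. Qed.

Lemma cvg_kernel_ratio (s : nat -> word N) u l : escaping s ->
  density_ratio u (s n) @[n --> \oo] --> l ->
  martin_kernel sim m u (s n) @[n --> \oo] --> kernel_scale u * l.
Proof.
move=> sinf cl.
have : kernel_scale u * density_ratio u (s n) @[n --> \oo] --> kernel_scale u * l.
  by apply: cvgM => //; exact: cvg_cst.
apply: cvg_trans; apply: near_eq_cvg.
by have := kernel_ratio_near u sinf; apply: filterS => n ->.
Qed.

Lemma cvg_ratio_kernel (s : nat -> word N) u l : escaping s ->
  martin_kernel sim m u (s n) @[n --> \oo] --> l ->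
  density_ratio u (s n) @[n --> \oo] --> (kernel_scale u)^-1 * l.
Proof.
move=> sinf cl; have c0 := lt0r_neq0 (kernel_scale_gt0 u).
have : (kernel_scale u)^-1 * martin_kernel sim m u (s n) @[n --> \oo]
       --> (kernel_scale u)^-1 * l.
  by apply: cvgM => //; exact: cvg_cst.
apply: cvg_trans; apply: near_eq_cvg.
have := kernel_ratio_near u sinf.
by apply: filterS => n ->; rewrite mulKf.
Qed.

Lemma cvgn_kernelP (s : nat -> word N) u : escaping s ->
  cvgn (fun n => martin_kernel sim m u (s n)) <->
  cvgn (fun n => density_ratio u (s n)).
Proof.
move=> sinf; split=> h; apply/cvg_ex.
  by exists ((kernel_scale u)^-1 * limn (fun n => martin_kernel sim m u (s n)));
    exact: cvg_ratio_kernel.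
by exists (kernel_scale u * limn (fun n => density_ratio u (s n)));
  exact: cvg_kernel_ratio.
Qed.

Lemma limn_kernel (s : nat -> word N) u : escaping s ->
  cvgn (fun n => density_ratio u (s n)) ->
  limn (fun n => martin_kernel sim m u (s n)) =
  kernel_scale u * limn (fun n => density_ratio u (s n)).
Proof. by move=> sinf h; apply: cvg_lim => //; exact: cvg_kernel_ratio. Qed.

(** * The boundary without masses *)

(** An eventually constant sequence cannot be equivalent to [s], because the
    kernels along [s] do not converge to those at a word.  On the remaining
    sequences the kernels are, eventually, the density ratios times constants
    that depend on the first argument only. *)
Lemma martin_class_escaping (a : word N -> R) (s : nat -> word N) :
  martin_weight sim m a -> escaping s ->
  (forall u, cvgn (fun n => density_ratio u (s n))) ->
  martin_class sim m a s = ratio_class s.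
Proof.
move=> wa sinf rs; apply/seteqP; split=> t /=.
  move=> [/(martin_cauchyP _ wa) ct st].
  have tinf : escaping t.
    have [|[w tw]] := convergent_cases ct; first exact.
    have [] := @escaping_not_eventually_word s w sinf; apply: eventually_word => u.
      exact: (cvgn_kernelP u sinf).2 (rs u).
    rewrite st; apply: lim_near_cst => //.
    by apply: filterS tw => n ->.
  split; [exact: tinf|move=> u]; have rt := (cvgn_kernelP u tinf).1 (ct u).
  split; [exact: rt|apply: (mulfI (lt0r_neq0 (kernel_scale_gt0 u)))].
  by rewrite -(limn_kernel sinf (rs u)) -(limn_kernel tinf rt); exact: st.
move=> [tinf rt]; split.
  by apply/(martin_cauchyP _ wa) => u; exact: (cvgn_kernelP u tinf).2 (rt u).1.
by move=> u; rewrite (limn_kernel sinf (rs u)) (limn_kernel tinf (rt u).1) (rt u).2.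
Qed.

(** The classes of the words are those of the eventually constant sequences, so
    removing them leaves the classes of the sequences of the other kind. *)
Theorem martin_boundaryE (a : word N -> R) : martin_weight sim m a ->
  martin_boundary sim m a = ratio_boundary.
Proof.
move=> wa; apply/seteqP; split=> X /=.
  move=> [[s /(martin_cauchyP _ wa) cs <-] notword].
  have [sinf|[w sw]] := convergent_cases cs; last first.
    exfalso; apply: notword; exists w => //.
    have e u : limn (fun n => martin_kernel sim m u (s n)) =
               martin_kernel sim m u w.
      by apply: lim_near_cst => //; apply: filterS sw => n ->.
    rewrite /martin_class; apply/seteqP; split=> t /= [ct st]; split=> // u.
      by rewrite e -st lim_cst.
    by rewrite lim_cst// -e st.
  have rs u := (cvgn_kernelP u sinf).1 (cs u).
  by exists s; [split|rewrite (martin_class_escaping wa sinf rs)].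
move=> [s [sinf rs] <-]; rewrite -(martin_class_escaping wa sinf rs).
have ks u := (cvgn_kernelP u sinf).2 (rs u).
have cs : martin_cauchy sim m a s by exact/martin_cauchyP.
split; first by exists s; first exact: cs.
move=> [w _ ws]; apply: (@escaping_not_eventually_word s w sinf).
have : martin_class sim m a (fun=> w) s by rewrite ws.
by move=> [_ we]; apply: eventually_word => // u; rewrite -we lim_cst.
Qed.

End Coherent.
End Chain.

Theorem theorem4 (R : realType) (d N : nat) (D : set 'rV[R]_d)
    (S : 'I_N -> 'rV[R]_d -> 'rV[R]_d) (c : 'I_N -> R) (K : set 'rV[R]_d)
    (m : 'I_N -> R) (a ahom : word N -> R)
    (hc : forall i, 0 < c i < 1)
    (hS : forall i, similitude D (S i) (c i))
    (hK : attractor D S K)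
    (hKconn : connected K)
    (hosc : open_set_condition D S)
    (hm : mass_distribution m)
    (ha : martin_weight (word_sim S K) m a)
    (hahom : martin_weight (word_sim S K) (@uniform_mass R N) ahom)
    (hequiv : RelationClasses.Equivalence (word_sim S K))
    (hkhom : martin_kernel_exists (word_sim S K) (@uniform_mass R N))
    (halt : forall w : word N,
       (forall w', word_sim S K w' w -> word_mass m w = word_mass m w') \/
       (forall w', word_sim S K w' w ->
          word_sim S K (parent w) (parent w'))) :
  martin_boundary (word_sim S K) m a =
  martin_boundary (word_sim S K) (@uniform_mass R N) ahom.
Proof.
have sim_size v w : word_sim S K v w -> size v = size w by case=> [->|[]].
have m_gt0 i : 0 < m i by case/andP: (hm.1 i).
have u_gt0 i : 0 < @uniform_mass R N i.
  by rewrite invr_gt0 ltr0n (leq_ltn_trans _ (ltn_ord i)).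
have uniform_halt w :
    (forall w', word_sim S K w' w ->
       word_mass (@uniform_mass R N) w = word_mass (@uniform_mass R N) w') \/
    (forall w', word_sim S K w' w -> word_sim S K (parent w) (parent w')).
  left=> w' /sim_size sw'.
  by rewrite /word_mass /uniform_mass !big_const_seq !count_predT sw'.
by rewrite (martin_boundaryE hequiv sim_size m_gt0 halt ha)
           (martin_boundaryE hequiv sim_size u_gt0 uniform_halt hahom).
Qed.
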